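(* Let $n\ge 2$ and let $X\subseteq(\mathbb{R}^n\times S^{n-1})^2$ be the set of all admissible pairs $\left((p_0,v_0),(p_1,v_1)\right)$ such that the vector component $v_\omega$ of the Bézier average $B_\omega\left((p_0,v_0),(p_1,v_1)\right)$ is nonzero for every $\omega\in[0,1]$. Then the Bézier average $(\omega,x)\mapsto B_\omega(x)$ is a Hermite average over $X$.
   Context: $\mathbb{R}^n$ carries the Euclidean inner product $\langle\cdot,\cdot\rangle$ and norm $\|\cdot\|$; $S^{n-1}$ is the unit sphere. For $p_0\ne p_1$ put $u=\frac{p_1-p_0}{\|p_1-p_0\|}$ and $\theta_j=\arccos\langle v_j,u\rangle\in[0,\pi]$, $j=0,1$. Admissible pair: $p_0\neq p_1$, and either $v_0=v_1=u$ or every two of the vectors $v_0,v_1,u$ are linearly independent. (Then $\theta_0+\theta_1<2\pi$.) Bézier average: put $\alpha=\dfrac{\|p_1-p_0\|}{3\cos^2\left(\frac{\theta_0+\theta_1}{4}\right)}$, and let $b(t)$, $t\in[0,1]$, be the cubic Bézier curve with control points $p_0,\ p_0+\alpha v_0,\ p_1-\alpha v_1,\ p_1$, i.e. $$b(t)=(1-t)^3p_0+3t(1-t)^2(p_0+\alpha v_0)+3t^2(1-t)(p_1-\alpha v_1)+t^3p_1.$$ For $\omega\in[0,1]$, $B_\omega\left((p_0,v_0),(p_1,v_1)\right)=(p_\omega,v_\omega)$ with $p_\omega=b(\omega)$ and $v_\omega=\frac{b'(\omega)}{\|b'(\omega)\|}$ if $b'(\omega)\ne0$, $v_\omega=0$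 if $b'(\omega)=0$. Hermite average: a map $H:[0,1]\times X\to\mathbb{R}^n\times S^{n-1}$, with $X\subseteq(\mathbb{R}^n\times S^{n-1})^2$, is a Hermite average over $X$ if for all $\omega\in[0,1]$ and all $\left((p_0,v_0),(p_1,v_1)\right)\in X$: (1) (identity on the limit diagonal) $H_\omega\left((p,v),(p+tv,v)\right)\to(p,v)$ as $t\to0^+$, for $(p,v)\in\mathbb{R}^n\times S^{n-1}$; (2) (symmetry with respect to orientation) if $H_\omega\left((p_0,v_0),(p_1,v_1)\right)=(p,v)$ then $H_{1-\omega}\left((p_1,-v_1),(p_0,-v_0)\right)=(p,-v)$; (3) (end points interpolation) $H_j\left((p_0,v_0),(p_1,v_1)\right)=(p_j,v_j)$ for $j=0,1$. *)

(* Defs.v *)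
From HB Require Import structures.
From mathcomp Require Export all_boot all_order all_algebra.
From mathcomp Require Export all_classical all_reals all_analysis.
Export numFieldNormedType.Exports.

Set Implicit Arguments.
Unset Strict Implicit.
Unset Printing Implicit Defensive.

Import Order.TTheory GRing.Theory Num.Theory.

Local Open Scope classical_set_scope.
Local Open Scope ring_scope.

Section Bezier.
Context {R : realType} {n : nat}.
Local Notation V := 'rV[R]_n.

Definition dotv (a b : V) : R := \sum_(i < n) a 0 i * b 0 i.

(* The library norm [`|a|] on ['rV[R]_n] is the sup norm, hence a separate
   Euclidean norm; both induce the same topology and derivatives. *)
Definition enorm (a : V) : R := Num.sqrt (dotv a a).

Definition sphere : set V := [set v | enorm v = 1].

Definition dir (p0 p1 : V) : V := (enorm (p1 - p0))^-1 *: (p1 - p0).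

Definition angle (p0 p1 v : V) : R := acos (dotv v (dir p0 p1)).

Definition admissible (p0 v0 p1 v1 : V) : Prop :=
  p0 <> p1 /\
  let u := dir p0 p1 in
  (v0 = u /\ v1 = u) \/
  [/\ free [:: v0; v1], free [:: v0; u] & free [:: v1; u]].

Definition bezier_alpha (p0 v0 p1 v1 : V) : R :=
  enorm (p1 - p0) /
  (3 * cos ((angle p0 p1 v0 + angle p0 p1 v1) / 4) ^+ 2).

Definition bezier_curve (p0 v0 p1 v1 : V) (t : R) : V :=
  let alpha := bezier_alpha p0 v0 p1 v1 in
  (1 - t) ^+ 3 *: p0
  + (3 * t * (1 - t) ^+ 2) *: (p0 + alpha *: v0)
  + (3 * t ^+ 2 * (1 - t)) *: (p1 - alpha *: v1)
  + t ^+ 3 *: p1.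

(* The polynomial curve is differentiated on all of R, which at the end points
   0 and 1 agrees with the one-sided derivative. *)
Definition bezier_average (w : R) (x : (V * V) * (V * V)) : V * V :=
  let: ((p0, v0), (p1, v1)) := x in
  let b := bezier_curve p0 v0 p1 v1 in
  let d : V := derive1 b w in
  (b w, if d == 0 then 0 else (enorm d)^-1 *: d).

Definition bezier_domain : set ((V * V) * (V * V)) :=
  [set x | let: ((p0, v0), (p1, v1)) := x in
    [/\ sphere v0, sphere v1, admissible p0 v0 p1 v1 &
        forall w : R, 0 <= w <= 1 -> (bezier_average w x).2 <> 0]].

(* A map [0,1] * X -> R^n * S^(n-1) is encoded as a total function of which
   only the values on [0,1] * X matter.  Accordingly, wherever the axioms
   evaluate H, the argument is required to lie in X: near 0+ for the limit, and
   for the reversed pair in the symmetry axiom. *)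
Record hermite_average (X : set ((V * V) * (V * V)))
    (H : R -> (V * V) * (V * V) -> V * V) : Prop := HermiteAverage {
  hermite_domain : forall p0 v0 p1 v1, X ((p0, v0), (p1, v1)) ->
    sphere v0 /\ sphere v1 ;
  hermite_codomain : forall (w : R) x, 0 <= w <= 1 -> X x -> sphere (H w x).2 ;
  hermite_diagonal : forall (w : R) (p v : V), 0 <= w <= 1 -> sphere v ->
    (\forall t \near 0^'+, X ((p, v), (p + t *: v, v))) /\
    H w ((p, v), (p + t *: v, v)) @[t --> 0^'+] --> (p, v) ;
  hermite_symmetry : forall (w : R) (p0 v0 p1 v1 : V), 0 <= w <= 1 ->
    X ((p0, v0), (p1, v1)) ->
    X ((p1, - v1), (p0, - v0)) /\
    forall p v : V, H w ((p0, v0), (p1, v1)) = (p, v) ->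
      H (1 - w) ((p1, - v1), (p0, - v0)) = (p, - v) ;
  hermite_endpoints : forall p0 v0 p1 v1, X ((p0, v0), (p1, v1)) ->
    H 0 ((p0, v0), (p1, v1)) = (p0, v0) /\
    H 1 ((p0, v0), (p1, v1)) = (p1, v1)
}.

End Bezier.

(* Main.v *)
Require Import Defs.
From mathcomp Require Import ring.

Set Implicit Arguments.
Unset Strict Implicit.
Unset Printing Implicit Defensive.

Import Order.TTheory GRing.Theory Num.Theory.

Local Open Scope classical_set_scope.
Local Open Scope ring_scope.

(** Everything follows from an explicit formula for the velocity of the cubic,
    [derive1_bezier_curve]: it is three times the quadratic Bernstein
    combination of the edges of the control polygon.

    - End points.  The velocities at 0 and 1 are [3 * alpha *: v0] and
      [3 * alpha *: v1], so the unit velocities are [v0] and [v1] as soon as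
      [alpha > 0].  Always [alpha >= 0], and [alpha = 0] would make the velocity
      vanish at 0, which the domain excludes.
    - Symmetry.  Replacing [(p0, v0), (p1, v1)] by [(p1, - v1), (p0, - v0)]
      negates the unit direction [u] along with both vectors, hence preserves
      both angles up to a swap, hence preserves [alpha].  The control polygon is
      therefore merely read backwards: the curve is reparametrized by
      [t |-> 1 - t] and its velocity changes sign ([bezier_average_rev]).
      Admissibility and the nonvanishing of the velocity are likewise preserved.
    - Diagonal.  On the pair [(p, v), (p + t *: v, v)] with [t > 0] both angles
      are 0, so [alpha = t / 3], the control points are equally spaced, and the
      curve is the segment run at constant velocity [t *: v]
      ([bezier_average_line]).  The average is [(p + (t * w) *: v, v)], which
      tends to [(p, v)] as [t] tends to 0. *)

(** * Two general facts *)

Lemma is_derive_scalel (R : realType) (V : normedModType R)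
    (k : R -> R) (t dk : R) (a : V) :
  is_derive t 1 k dk -> is_derive t 1 (fun s => k s *: a) (dk *: a).
Proof.
move=> kdk.
have kdiff : differentiable k t by apply/derivable1_diffP/ex_derive.
have comp_diff : is_diff t (( *:%R^~ a) \o k) (( *:%R^~ a) \o 'd k t).
  exact: (is_diff_comp (differentiableP kdiff) (is_diff_scalel (k t) a)).
have comp_differentiable := @ex_diff _ _ _ _ _ _ _ comp_diff.
apply: DeriveDef; first exact: diff_derivable comp_differentiable.
rewrite (deriveE _ comp_differentiable) (@diff_val _ _ _ _ _ _ _ comp_diff) /=.
by rewrite -deriveE// derive_val.
Qed.

Lemma freeNN (K : fieldType) (vT : vectType K) (a b : vT) :
  free [:: - a; - b] = free [:: a; b].
Proof.
have lineN : (<[- b]> = <[b]>)%VS.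
  apply/eqP; rewrite eqEsubv -!memvE memvN memv_line /=.
  by rewrite -(opprK b) memvN opprK memv_line.
by rewrite !free_cons !span_seq1 !nil_free !span_nil !memv0 oppr_eq0 memvN lineN.
Qed.

(** * Euclidean norm and normalization *)

Section Euclidean.
Context {R : realType} {n : nat}.
Local Notation V := 'rV[R]_n.
Implicit Types (a b v : V) (c : R).

Lemma dotvNN a b : dotv (- a) (- b) = dotv a b.
Proof. by apply: eq_bigr => i _; rewrite !mxE mulrNN. Qed.

Lemma dotv_ge0 a : 0 <= dotv a a.
Proof. by apply: sumr_ge0 => i _; rewrite -expr2 sqr_ge0. Qed.

Lemma enorm_ge0 a : 0 <= enorm a.
Proof. exact: sqrtr_ge0. Qed.

Lemma enormN a : enorm (- a) = enorm a.
Proof. by rewrite /enorm dotvNN. Qed.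

Lemma enormZ c a : enorm (c *: a) = `|c| * enorm a.
Proof.
rewrite /enorm -sqrtr_sqr -sqrtrM ?sqr_ge0//; congr Num.sqrt.
by rewrite /dotv mulr_sumr; apply: eq_bigr => i _; rewrite !mxE; ring.
Qed.

Lemma enorm_eq0 a : (enorm a == 0) = (a == 0).
Proof.
apply/idP/eqP => [|->]; last first.
  by rewrite -(scale0r (0 : V)) enormZ normr0 mul0r.
rewrite sqrtr_eq0 => a_le0.
have /eqP : dotv a a = 0 by apply/le_anti; rewrite a_le0 dotv_ge0.
rewrite psumr_eq0 => [/allP a0|i _]; last by rewrite -expr2 sqr_ge0.
apply/rowP => i; rewrite mxE.
by have := a0 i (mem_index_enum _); rewrite -expr2 sqrf_eq0 => /eqP.
Qed.

Lemma dotv_unit v : enorm v = 1 -> dotv v v = 1.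
Proof. by move=> v1; rewrite -(sqr_sqrtr (dotv_ge0 v)) -/(enorm v) v1 expr1n. Qed.

Lemma unit_neq0 v : enorm v = 1 -> v != 0.
Proof. by rewrite -enorm_eq0 => ->; exact: oner_neq0. Qed.

(** The value at 0 is chosen so that normalization commutes with the opposite
    without exception. *)
Definition normalize v : V := if v == 0 then 0 else (enorm v)^-1 *: v.

Lemma normalizeN v : normalize (- v) = - normalize v.
Proof.
by rewrite /normalize oppr_eq0 enormN; case: ifP; rewrite ?oppr0// scalerN.
Qed.

Lemma enorm_normalize v : normalize v <> 0 -> enorm (normalize v) = 1.
Proof.
rewrite /normalize; case: ifPn => // v0 _.
by rewrite enormZ normfV ger0_norm ?enorm_ge0// mulVf// enorm_eq0.
Qed.

Lemma normalizeZ c v : 0 < c -> enorm v = 1 -> normalize (c *: v) = v.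
Proof.
move=> c0 v1; rewrite /normalize scaler_eq0 gt_eqF//= (negbTE (unit_neq0 v1)).
by rewrite enormZ v1 mulr1 gtr0_norm// scalerA mulVf ?scale1r// gt_eqF.
Qed.

End Euclidean.

(** * The Bezier average *)

Section BezierFacts.
Context {R : realType} {n : nat}.
Local Notation V := 'rV[R]_n.
Implicit Types (p v : V) (t w : R).

(** The control polygon has edges [alpha *: v0],
    [p1 - p0 - alpha *: (v0 + v1)] and [alpha *: v1]; a cubic Bezier curve has
    as hodograph three times the quadratic Bezier curve on these edges. *)
Definition bezier_velocity p0 v0 p1 v1 t : V :=
  let alpha := bezier_alpha p0 v0 p1 v1 in
  3 *: ((1 - t) ^+ 2 *: (alpha *: v0)
        + (2 * t * (1 - t)) *: (p1 - p0 - alpha *: (v0 + v1))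
        + t ^+ 2 *: (alpha *: v1)).

Lemma derive1_bezier_curve p0 v0 p1 v1 t :
  derive1 (bezier_curve p0 v0 p1 v1) t = bezier_velocity p0 v0 p1 v1 t.
Proof.
have d0 : is_derive t 1 (fun s : R => (1 - s) ^+ 3) (- (3 * (1 - t) ^+ 2)).
  by apply: is_derive_eq; rewrite /GRing.scale/=; ring.
have d1 : is_derive t 1 (fun s : R => 3 * s * (1 - s) ^+ 2)
    (3 * (1 - t) ^+ 2 - 6 * t * (1 - t)).
  by apply: is_derive_eq; rewrite /GRing.scale/=; ring.
have d2 : is_derive t 1 (fun s : R => 3 * s ^+ 2 * (1 - s))
    (6 * t * (1 - t) - 3 * t ^+ 2).
  by apply: is_derive_eq; rewrite /GRing.scale/=; ring.
have d3 : is_derive t 1 (fun s : R => s ^+ 3) (3 * t ^+ 2).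
  by apply: is_derive_eq; rewrite /GRing.scale/=; ring.
set alpha := bezier_alpha p0 v0 p1 v1.
have d := is_deriveD (is_deriveD (is_deriveD
  (is_derive_scalel p0 d0) (is_derive_scalel (p0 + alpha *: v0) d1))
  (is_derive_scalel (p1 - alpha *: v1) d2)) (is_derive_scalel p1 d3).
rewrite derive1E (@derive_val _ _ _ _ _ _ _ d).
by apply/rowP => i; rewrite /bezier_velocity -/alpha !mxE; ring.
Qed.

Lemma bezier_averageE p0 v0 p1 v1 w :
  bezier_average w ((p0, v0), (p1, v1)) =
  (bezier_curve p0 v0 p1 v1 w, normalize (bezier_velocity p0 v0 p1 v1 w)).
Proof. by rewrite /bezier_average derive1_bezier_curve. Qed.

Lemma bezier_alpha_ge0 p0 v0 p1 v1 : 0 <= bezier_alpha p0 v0 p1 v1.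
Proof. by rewrite divr_ge0 ?enorm_ge0// mulr_ge0// sqr_ge0. Qed.

Lemma dir_rev p0 p1 : dir p1 p0 = - dir p0 p1.
Proof. by rewrite /dir -(opprB p1) enormN scalerN. Qed.

Lemma angle_rev p0 p1 v : angle p1 p0 (- v) = angle p0 p1 v.
Proof. by rewrite /angle dir_rev dotvNN. Qed.

Lemma bezier_alpha_rev p0 v0 p1 v1 :
  bezier_alpha p1 (- v1) p0 (- v0) = bezier_alpha p0 v0 p1 v1.
Proof.
by rewrite /bezier_alpha !angle_rev -(opprB p1) enormN [angle _ _ v1 + _]addrC.
Qed.

(** The reversed pair has the same [alpha], hence the same control polygon in
    the opposite order. *)
Lemma bezier_average_rev p0 v0 p1 v1 w :
  bezier_average (1 - w) ((p1, - v1), (p0, - v0)) =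
  ((bezier_average w ((p0, v0), (p1, v1))).1,
   - (bezier_average w ((p0, v0), (p1, v1))).2).
Proof.
rewrite !bezier_averageE /= -normalizeN; congr (_, normalize _).
  by rewrite /bezier_curve bezier_alpha_rev; apply/rowP => i; rewrite !mxE; ring.
by rewrite /bezier_velocity bezier_alpha_rev; apply/rowP => i; rewrite !mxE; ring.
Qed.

Lemma admissible_rev p0 v0 p1 v1 :
  admissible p0 v0 p1 v1 -> admissible p1 (- v1) p0 (- v0).
Proof.
move=> [p01 v01]; split; first by move=> p10; apply: p01.
rewrite /= dir_rev; case: v01 => [[-> ->]|[f01 f0 f1]]; first by left.
right; rewrite !freeNN; split => //.
by rewrite (perm_free (Y := [:: v0; v1]))// (perm_catC [:: v1] [:: v0]).
Qed.

Lemma bezier_domain_rev p0 v0 p1 v1 :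
  bezier_domain ((p0, v0), (p1, v1)) ->
  bezier_domain ((p1, - v1), (p0, - v0)).
Proof.
move=> [s0 s1 adm nz]; split.
- by rewrite /sphere /= enormN.
- by rewrite /sphere /= enormN.
- exact: admissible_rev.
move=> w /andP[w0 w1].
have -> : w = 1 - (1 - w) by rewrite subKr.
rewrite bezier_average_rev /= => /eqP; rewrite oppr_eq0 => /eqP.
by apply: nz; rewrite subr_ge0 w1 lerBlDr lerDl.
Qed.

(** If [alpha] were 0, both inner control points would coincide with the end
    points and the velocity would vanish at time 0. *)
Lemma bezier_domain_alpha_gt0 p0 v0 p1 v1 :
  bezier_domain ((p0, v0), (p1, v1)) -> 0 < bezier_alpha p0 v0 p1 v1.
Proof.
move=> [_ _ _ /(_ 0)]; rewrite lexx ler01 bezier_averageE/= => /(_ isT) nz.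
rewrite lt_neqAle bezier_alpha_ge0 andbT eq_sym; apply/eqP => alpha0; apply: nz.
rewrite /bezier_velocity alpha0 /normalize ifT//; apply/eqP/rowP => i.
by rewrite !mxE; ring.
Qed.

Lemma bezier_average_endpoints p0 v0 p1 v1 :
  bezier_domain ((p0, v0), (p1, v1)) ->
  bezier_average 0 ((p0, v0), (p1, v1)) = (p0, v0) /\
  bezier_average 1 ((p0, v0), (p1, v1)) = (p1, v1).
Proof.
move=> X01; have alpha_gt0 := bezier_domain_alpha_gt0 X01.
have [s0 s1 _ _] := X01.
set alpha := bezier_alpha p0 v0 p1 v1 in alpha_gt0 *.
have alpha3 : 0 < 3 * alpha by rewrite mulr_gt0.
rewrite !bezier_averageE /bezier_curve /bezier_velocity -/alpha.
split; congr pair.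
- by apply/rowP => i; rewrite !mxE; ring.
- rewrite -[RHS](normalizeZ alpha3 s0); congr normalize.
  by apply/rowP => i; rewrite !mxE; ring.
- by apply/rowP => i; rewrite !mxE; ring.
- rewrite -[RHS](normalizeZ alpha3 s1); congr normalize.
  by apply/rowP => i; rewrite !mxE; ring.
Qed.

Lemma dir_line p v t : 0 < t -> enorm v = 1 -> dir p (p + t *: v) = v.
Proof.
move=> t0 v1; rewrite /dir addrC addKr enormZ v1 mulr1 gtr0_norm//.
by rewrite scalerA mulVf ?scale1r// gt_eqF.
Qed.

Lemma bezier_alpha_line p v t : 0 < t -> enorm v = 1 ->
  bezier_alpha p v (p + t *: v) v = t / 3.
Proof.
move=> t0 v1; rewrite /bezier_alpha /angle dir_line// dotv_unit// acos1.
rewrite addr0 mul0r cos0 expr1n mulr1 [p + _]addrC addrK enormZ v1 mulr1.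
by rewrite gtr0_norm.
Qed.

(** With [alpha = t / 3] the four control points are equally spaced on a line,
    so the cubic degenerates to the affine parametrization of the segment. *)
Lemma bezier_average_line p v t w : 0 < t -> enorm v = 1 ->
  bezier_average w ((p, v), (p + t *: v, v)) = (p + (t * w) *: v, v).
Proof.
move=> t0 v1; rewrite bezier_averageE /bezier_curve /bezier_velocity.
rewrite bezier_alpha_line//; congr pair.
  by apply/rowP => i; rewrite !mxE; field.
rewrite -[RHS](normalizeZ t0 v1); congr normalize.
by apply/rowP => i; rewrite !mxE; field.
Qed.

Lemma bezier_domain_line p v t : 0 < t -> enorm v = 1 ->
  bezier_domain ((p, v), (p + t *: v, v)).
Proof.
move=> t0 v1; split => //.
- split; last by left; rewrite dir_line.
  move=> /esym/eqP; rewrite -subr_eq0 addrC addKr scaler_eq0 gt_eqF//=.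
  by rewrite (negbTE (unit_neq0 v1)).
- by move=> w _; rewrite bezier_average_line//=; apply/eqP/unit_neq0.
Qed.

Lemma bezier_average_diagonal p v w : enorm v = 1 ->
  bezier_average w ((p, v), (p + t *: v, v)) @[t --> 0^'+] --> (p, v).
Proof.
move=> v1; apply: cvg_trans (_ : (p + (t * w) *: v, v) @[t --> 0^'+] --> _).
  apply: near_eq_cvg; by near=> t; rewrite bezier_average_line.
have point_cvg : p + (t * w) *: v @[t --> 0^'+] --> p.
  apply: cvg_at_right_filter.
  have {2}-> : p = p + (0 * w) *: v by rewrite mul0r scale0r addr0.
  apply: cvgD; first exact: cvg_cst.
  by apply: cvgZr_tmp; apply: cvgMr_tmp; exact: cvg_id.
exact: (@cvg_pair _ _ _ _ (nbhs p) (nbhs v) _ _ _ _ _ point_cvg (cvg_cst v)).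
Unshelve. all: by end_near. Qed.

End BezierFacts.

Theorem proposition2p7 (R : realType) (n : nat) (hn : (2 <= n)%N) :
  hermite_average (@bezier_domain R n) (@bezier_average R n).
Proof.
split.
- by move=> p0 v0 p1 v1 [].
- move=> w [[p0 v0] [p1 v1]] w01 [_ _ _ /(_ w w01)].
  by rewrite bezier_averageE; exact: enorm_normalize.
- move=> w p v _ v1; split; last exact: bezier_average_diagonal.
  by near=> t; apply: bezier_domain_line => //; near: t; exact: nbhs_right_gt.
- move=> w p0 v0 p1 v1 _ X01; split; first exact: bezier_domain_rev.
  by move=> p v Hw; rewrite bezier_average_rev Hw.
- exact: bezier_average_endpoints.
Unshelve. all: by end_near. Qed.
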